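(* Let $N\ge 1$, let $0<n_1<\cdots<n_N$ be distinct positive integers, and let $a_1,\dots,a_N\in\mathbb{C}$ be not all zero. For $x\in\mathbb{T}$ let $P(x)=\sum_{k=1}^N a_k e^{in_kx}=f(x)+i\widetilde f(x)$, where $f$ and $\widetilde f$ are the real and imaginary parts of $P$, and let $M=-\min_{x\in\mathbb{T}} f(x)$. Let $G=\sum_{j=0}^\infty \frac{(-1)^j}{(2j+1)^2}$ be Catalan's constant. Then $$M\ \ge\ \frac{\pi^2}{32\,G}\,\frac{\sum_{k=1}^N|a_k|^2}{\|\widetilde f\|_\infty}.$$ In particular, if $|a_k|\ge 1$ for all $k=1,\dots,N$, then $$M\ \ge\ \frac{\pi^2}{32\,G}\,\frac{N}{\|\widetilde f\|_\infty}.$$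
   Context: $\mathbb{T}=\mathbb{R}/2\pi\mathbb{Z}$, and $\|g\|_\infty=\sup_{x\in\mathbb{T}}|g(x)|$ for continuous $g$ on $\mathbb{T}$. *)

(* Defs.v *)
(* MathComp-Analysis over an arbitrary [R : realType]; complex numbers are
   [R[i]] from mathcomp-real-closed.
   A function on the circle T = R / 2 pi Z is given by its 2 pi-periodic lift
   to R, so that extrema over T are extrema over R. *)
From HB Require Import structures.
From mathcomp Require Import all_boot all_order all_algebra.
From mathcomp Require Import all_classical all_reals all_analysis.
From mathcomp Require Export complex.
From mathcomp Require Import ring lra zify.

Set Implicit Arguments.
Unset Strict Implicit.
Unset Printing Implicit Defensive.

Import Order.TTheory GRing.Theory Num.Theory.
Import numFieldNormedType.Exports.

Local Open Scope classical_set_scope.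
Local Open Scope ring_scope.

(* e^{it}, by Euler's formula *)
Definition expi (R : realType) (t : R) : R[i] := Complex (cos t) (sin t).

Definition trig_poly (R : realType) (N : nat) (n : 'I_N -> nat)
    (a : 'I_N -> R[i]) (x : R) : R[i] :=
  \sum_(k < N) a k * expi ((n k)%:R * x).

(* The library's [`|z|] on [R[i]] takes values in [R[i]]; [cabs] is the
   real-valued modulus, see [cabsE]. *)
Definition cabs (R : realType) (z : R[i]) : R := ComplexField.Normc.normc z.

(* For g continuous and 2 pi-periodic the infimum is attained, so this is the
   minimum of g over T: see [minT_attained]. *)
Definition minT (R : realType) (g : R -> R) : R := inf (range g).

Definition supnormT (R : realType) (g : R -> R) : R :=
  sup (range (fun x => `|g x|)).

(* The series converges: see [is_cvg_catalan]. *)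
Definition catalan (R : realType) : R :=
  limn (series (fun j : nat => (-1) ^+ j / (j.*2.+1)%:R ^+ 2 : R)).

Lemma cabsE (R : realType) (z : R[i]) : `|z| = (cabs z)%:C%C.
Proof. by case: z. Qed.

Lemma periodic_reduce (R : realType) (g : R -> R) (x : R) :
  periodic g (pi *+ 2) ->
  exists2 y, y \in `[0, pi *+ 2] & g y = g x.
Proof.
move=> gper.
have T0 : 0 < (pi *+ 2 : R) by rewrite mulrn_wgt0 ?pi_gt0.
have gz (m : int) u : g (u + (pi *+ 2) *~ m) = g u.
  case: m => m; first exact: periodicn.
  rewrite NegzE mulrNz; set v := u - _.
  by rewrite -(periodicn gper m.+1 v) /v -pmulrn subrK.
exists (x - (pi *+ 2) *~ Num.floor (x / (pi *+ 2))); last by rewrite -mulrNz gz.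
have /andP[h1 h2] := Num.Theory.floor_itv (x / (pi *+ 2)).
rewrite in_itv /= subr_ge0 lerBlDr -mulrzl -ler_pdivlMr// h1 /=.
rewrite -[X in X + _]mul1r -mulrDl -ler_pdivrMr// ltW//.
by rewrite addrC -intrD1.
Qed.

Lemma minT_attained (R : realType) (g : R -> R) :
  continuous g -> periodic g (pi *+ 2) ->
  exists2 x0, minT g = g x0 & forall x, g x0 <= g x.
Proof.
move=> gcont gper.
have T0 : 0 <= (pi *+ 2 : R) by rewrite mulrn_wge0 ?pi_ge0.
have [c _ hc] := EVT_min T0 (continuous_subspaceT gcont).
have cmin x : g c <= g x.
  by have [y yT <-] := periodic_reduce x gper; exact: hc.
exists c => //; apply/eqP; rewrite eq_le; apply/andP; split.
  by apply: ge_inf; [exists (g c) => _ [x _ <-]| exists c].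
by apply: lb_le_inf; [exists (g c); exists c | move=> _ [x _ <-]].
Qed.

Lemma supnormT_attained (R : realType) (g : R -> R) :
  continuous g -> periodic g (pi *+ 2) ->
  exists2 x0, supnormT g = `|g x0| & forall x, `|g x| <= `|g x0|.
Proof.
move=> gcont gper.
have hcont : continuous (fun x => - `|g x|).
  by move=> x; apply: cvgN; apply: cvg_norm; exact: gcont.
have hper : periodic (fun x => - `|g x|) (pi *+ 2) by move=> x; rewrite gper.
have [c _ hc] := minT_attained hcont hper.
have cmax x : `|g x| <= `|g c| by rewrite -lerN2.
exists c => //; apply/eqP; rewrite eq_le; apply/andP; split.
  by apply: ge_sup; [exists `|g c|; exists c | move=> _ [x _ <-]].
by apply: ub_le_sup; [exists `|g c| => _ [x _ <-]| exists c].
Qed.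

Lemma periodic_Re_trig_poly (R : realType) (N : nat) (n : 'I_N -> nat)
    (a : 'I_N -> R[i]) :
  periodic (fun x => complex.Re (trig_poly n a x)) (pi *+ 2).
Proof.
move=> x; congr complex.Re; apply: eq_bigr => k _; congr (_ * _).
rewrite /expi mulrDr [(n k)%:R * (pi *+ 2)]mulr_natl.
by rewrite (periodicn (@cosD2pi R)) (periodicn (@sinD2pi R)).
Qed.

Lemma continuous_Re_trig_poly (R : realType) (N : nat) (n : 'I_N -> nat)
    (a : 'I_N -> R[i]) :
  continuous (fun x => complex.Re (trig_poly n a x)).
Proof.
rewrite /trig_poly; elim: (index_enum _) => [|k r IH].
  under eq_fun do rewrite big_nil; exact: cst_continuous.
have -> : (fun x => complex.Re
      (\sum_(i <- k :: r) a i * expi ((n i)%:R * x))) =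
    (fun x => complex.Re (a k) * cos ((n k)%:R * x) -
              complex.Im (a k) * sin ((n k)%:R * x) +
              complex.Re (\sum_(i <- r) a i * expi ((n i)%:R * x))).
  apply/funext => x; rewrite big_cons.
  by case: (a k) => ? ?; case: (\sum_(_ <- _) _).
have lin : continuous (fun x : R => (n k)%:R * x).
  by move=> x; exact: mulrl_continuous.
move=> x; apply: cvgD; last exact: IH.
apply: cvgB; (apply: cvgM; first exact: cvg_cst).
- exact: continuous_comp (lin x) (@continuous_cos R _).
- exact: continuous_comp (lin x) (@continuous_sin R _).
Qed.

Lemma is_cvg_catalan (R : realType) :
  cvgn (series (fun j : nat => (-1) ^+ j / (j.*2.+1)%:R ^+ 2 : R)).
Proof.
apply: normed_cvg; apply: nondecreasing_is_cvgn.
  by apply: nondecreasing_series => j _ _; exact: normr_ge0.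
exists 2 => _ [m _ <-]; rewrite /series /=.
suff : \sum_(0 <= j < m) `|(-1) ^+ j / (j.*2.+1)%:R ^+ 2 : R| <=
    2 - m.+1%:R^-1.
  by move/le_trans; apply; rewrite gerBl invr_ge0.
elim: m => [|m IH].
  by rewrite big_nil invr1; lra.
rewrite big_nat_recr//= normrM normrX normrN1 expr1n mul1r ger0_norm; last first.
  by rewrite invr_ge0 exprn_ge0.
case: m IH => [_|m IH].
  by rewrite big_nil add0r expr1n invr1; lra.
apply: le_trans (lerD IH (lexx _)) _.
have -> : ((m.+1).*2.+1)%:R = 2 * m%:R + 3 :> R.
  by rewrite -[3]/(3%:R) -[2]/(2%:R) -natrM -natrD; congr _%:R; rewrite -muln2; lia.
rewrite -[m.+3]addn3 -[m.+2]addn2 !natrD.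
have m0 : 0 <= m%:R :> R by [].
move: (m%:R) m0 => t t0.
have h : 0 <= (t + 2)^-1 - (t + 3)^-1 - ((2 * t + 3) ^+ 2)^-1.
  have -> : (t + 2)^-1 - (t + 3)^-1 - ((2 * t + 3) ^+ 2)^-1 =
      (3 * t ^+ 2 + 7 * t + 3) / ((t + 2) * (t + 3) * (2 * t + 3) ^+ 2).
    by field; rewrite ?gt_eqF; lra.
  apply: divr_ge0; first by rewrite !addr_ge0 ?mulr_ge0 ?exprn_ge0.
  by rewrite !mulr_ge0 ?exprn_ge0 ?addr_ge0 ?mulr_ge0.
lra.
Qed.

(* Main.v *)
Require Import Defs.
From mathcomp Require Import all_boot all_order all_algebra.
From mathcomp Require Import all_classical all_reals all_analysis.
From mathcomp Require Import ring lra zify.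

Set Implicit Arguments.
Unset Strict Implicit.
Unset Printing Implicit Defensive.

Import Order.TTheory GRing.Theory Num.Theory.
Import numFieldNormedType.Exports.

Local Open Scope ring_scope.

(* Rescale by [c = pi / (2 V)], [V] the sup norm of [f~]: then [c (P + M)] maps
   the unit disc into the half strip [u >= 0, |v| <= pi / 2].  There [v ^ 2] lies
   below the harmonic function with the same boundary values,
     pi^2 / 4 - (8 / pi) Re sum_j (-1)^j e^{-(2j+1)(u+iv)} / (2j+1)^3,
   which is a power series in [e^{-(u+iv)}], so its mean over the circle is its
   value at [u = c M, v = 0].  The mean of [v ^ 2] is [c^2 sum |a_k|^2 / 2], while
   the value at [c M] is at most [(8 / pi) G c M]: it vanishes at [0] and its
   derivative is at most [(8 / pi) G].
   Series are replaced by partial sums evaluated at [q e^{-u}], [q < 1], with an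
   explicit truncation error, and means over the circle by averages over [Q]-th
   roots of unity, which are exact on polynomials of degree less than [Q]. *)

(** * Differentiation rules in pointwise form and comparison of functions through their
    derivatives *)

Section Monotonicity.
Local Open Scope classical_set_scope.
Local Open Scope ring_scope.
Context {R : realType}.
Implicit Types (f g df : R -> R) (x a b : R).

Lemma derive_pointwiseD f g x a b : is_derive x 1 f a -> is_derive x 1 g b ->
  is_derive x 1 (fun t => f t + g t) (a + b).
Proof. exact: is_deriveD. Qed.

Lemma derive_pointwiseB f g x a b : is_derive x 1 f a -> is_derive x 1 g b ->
  is_derive x 1 (fun t => f t - g t) (a - b).
Proof. exact: is_deriveB. Qed.

Lemma derive_pointwiseZ f x (k : R) a : is_derive x 1 f a ->
  is_derive x 1 (fun t => k * f t) (k * a).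
Proof. exact: is_deriveZ. Qed.

Lemma derive_pointwiseM f g x a b : is_derive x 1 f a -> is_derive x 1 g b ->
  is_derive x 1 (fun t => f t * g t) (f x * b + g x * a).
Proof. exact: is_deriveM. Qed.

Lemma derive_pointwiseX f n x a : is_derive x 1 f a ->
  is_derive x 1 (fun t => f t ^+ n) (n%:R * f x ^+ n.-1 * a).
Proof.
move=> fa; have := @is_deriveX _ _ f n x 1 a fa.
by rewrite exprfctE.
Qed.

Lemma derive_pointwise_sum n (F : 'I_n -> R -> R) x (D : 'I_n -> R) :
  (forall i, is_derive x 1 (F i) (D i)) ->
  is_derive x 1 (fun t => \sum_(i < n) F i t) (\sum_(i < n) D i).
Proof.
move=> /is_derive_sum; congr (is_derive _ _ _ _).
by apply/funext => t; rewrite fct_sumE.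
Qed.

Lemma derive_pointwise_linear (k x : R) : is_derive x 1 (fun t => k * t) k.
Proof.
by rewrite -[X in is_derive _ _ _ X]mulr1; apply: derive_pointwiseZ.
Qed.

Lemma derive_pointwise_comp f g x a b : is_derive (g x) 1 f a ->
  is_derive x 1 g b -> is_derive x 1 (fun t => f (g t)) (a * b).
Proof. exact: is_derive1_comp. Qed.

Lemma ge0_derive_le f df a b : a <= b ->
  (forall x, a <= x <= b -> is_derive x 1 f (df x)) ->
  (forall x, a <= x <= b -> 0 <= df x) -> f a <= f b.
Proof.
move=> ab fdf df0.
have fd x : x \in `]a, b[ -> is_derive x 1 f (df x).
  by rewrite in_itv /= => /andP[/ltW ax /ltW xb]; apply: fdf; rewrite ax.
have fc : {within `[a, b]%classic, continuous f}.
  apply: continuous_in_subspaceT => x; rewrite inE /= in_itv /= => xab.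
  have [fx _] := fdf _ xab.
  exact/differentiable_continuous/derivable1_diffP.
have [c] := MVT_segment ab fd fc; rewrite in_itv /= => cab fba.
by rewrite -subr_ge0 fba mulr_ge0 ?subr_ge0 ?df0.
Qed.

(** Both [g - f] and [g + f] are nondecreasing. This stands in for integration: a bound on a
    derivative becomes a bound on an increment. *)
Lemma derive_norm_le f g df dg a b : a <= b ->
  (forall x, a <= x <= b -> is_derive x 1 f (df x)) ->
  (forall x, a <= x <= b -> is_derive x 1 g (dg x)) ->
  (forall x, a <= x <= b -> `|df x| <= dg x) -> `|f b - f a| <= g b - g a.
Proof.
move=> ab fdf gdg dfg.
have h1 : g a - f a <= g b - f b.
  apply: (@ge0_derive_le (fun t => g t - f t) (fun t => dg t - df t)) ab _ _ => x xab.
    exact: derive_pointwiseB (gdg _ xab) (fdf _ xab).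
  by have := dfg _ xab; rewrite ler_norml => /andP[]; lra.
have h2 : g a + f a <= g b + f b.
  apply: (@ge0_derive_le (fun t => g t + f t) (fun t => dg t + df t)) ab _ _ => x xab.
    exact: derive_pointwiseD (gdg _ xab) (fdf _ xab).
  by have := dfg _ xab; rewrite ler_norml => /andP[]; lra.
by rewrite ler_norml; apply/andP; split; lra.
Qed.

End Monotonicity.

(** * Alternating sums with decreasing terms *)

Section AlternatingSums.
Context {R : realDomainType}.

(** Removing the first term leaves minus a sum of the same shape for the shifted sequence, which
    lies between [0] and [b 1]. *)
Lemma alternating_sum_bounds (b : nat -> R) (J : nat) :
  (forall j, 0 <= b j) -> (forall j, b j.+1 <= b j) ->
  0 <= \sum_(j < J) (-1) ^+ j * b j <= b 0%N.
Proof.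
elim: J b => [|J IH] b b0 bdec; first by rewrite big_ord0 lexx b0.
rewrite big_ord_recl /= expr0 mul1r.
have /andP[h1 h2] := IH (fun j => b j.+1) (fun j => b0 j.+1) (fun j => bdec j.+1).
have -> : \sum_(i < J) (-1) ^+ bump 0 i * b (bump 0 i) =
    - \sum_(j < J) (-1) ^+ j * b j.+1.
  rewrite -sumrN; apply: eq_bigr => j _.
  by rewrite /bump /= add1n exprS mulN1r mulNr.
by have := bdec 0%N; lra.
Qed.

End AlternatingSums.

(** * Partial sums of the harmonic majorant: derivatives, closed form, comparison with the
    arctangent *)

Section PartialSums.
Context {R : realType}.
Implicit Types (q v : R) (J k : nat).

Definition oddn (j : nat) : R := (j.*2.+1)%:R.

Lemma oddn_gt0 j : 0 < oddn j. Proof. by rewrite ltr0n. Qed.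

Lemma oddnS j : oddn j <= oddn j.+1. Proof. by rewrite ler_nat; lia. Qed.

(* [alt_cos J k (expR (- u)) v] is the real part of the [J]-th partial sum of
   [sum_j (-1)^j e^{-(2j+1)(u+iv)} / (2j+1)^k]. *)
Definition alt_cos J k q v : R :=
  \sum_(j < J) (-1) ^+ j * (q ^+ j.*2.+1 / oddn j ^+ k) * cos (oddn j * v).

(** Minus the imaginary part of the same partial sum. Differentiation in [v] exchanges the two
    families up to sign and lowers [k] by one. *)
Definition alt_sin J k q v : R :=
  \sum_(j < J) (-1) ^+ j * (q ^+ j.*2.+1 / oddn j ^+ k) * sin (oddn j * v).

Lemma derive_alt_cos_v J k q v :
  is_derive v 1 (alt_cos J k.+1 q) (- alt_sin J k q v).
Proof.
rewrite -sumrN; apply: derive_pointwise_sum => j.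
have h := derive_pointwise_comp (is_derive_cos (oddn j * v))
  (derive_pointwise_linear (oddn j) v).
apply: is_derive_eq (derive_pointwiseZ _ h) _.
by rewrite [oddn j ^+ k.+1]exprS; field;
  rewrite ?expf_neq0 ?gt_eqF ?oddn_gt0.
Qed.

Lemma derive_alt_sin_v J k q v :
  is_derive v 1 (alt_sin J k.+1 q) (alt_cos J k q v).
Proof.
apply: derive_pointwise_sum => j.
have h := derive_pointwise_comp (is_derive_sin (oddn j * v))
  (derive_pointwise_linear (oddn j) v).
apply: is_derive_eq (derive_pointwiseZ _ h) _.
by rewrite [oddn j ^+ k.+1]exprS; field;
  rewrite ?expf_neq0 ?gt_eqF ?oddn_gt0.
Qed.

Lemma derive_alt_cos_q J k q v : is_derive q 1 (alt_cos J k.+1 ^~ v)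
  (\sum_(j < J) (-1) ^+ j * (q ^+ j.*2 / oddn j ^+ k) * cos (oddn j * v)).
Proof.
apply: derive_pointwise_sum => j.
have h := derive_pointwiseX j.*2.+1 (is_derive_id q 1).
have := derive_pointwiseZ ((-1) ^+ j / oddn j ^+ k.+1 * cos (oddn j * v)) h.
set F := (X in is_derive _ _ X _); set G := (X in _ -> is_derive _ _ X _).
have -> : F = G by apply/funext => t; rewrite /F /G; ring.
move=> h'; apply: is_derive_eq h' _.
by rewrite -/(oddn j) /= [oddn j ^+ k.+1]exprS; field;
  rewrite ?expf_neq0 ?gt_eqF ?oddn_gt0.
Qed.

Lemma alt_sin0 J k q : alt_sin J k q 0 = 0.
Proof. by apply: big1 => j _; rewrite mulr0 sin0 mulr0. Qed.

Lemma alt_cosN J k q v : alt_cos J k q (- v) = alt_cos J k q v.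
Proof. by apply: eq_bigr => j _; rewrite mulrN cosN. Qed.

Lemma alt_cos_q0 J k v : alt_cos J k 0 v = 0.
Proof. by apply: big1 => j _; rewrite expr0n mul0r mulr0 mul0r. Qed.

Lemma alt_cos_pihalf J k q : alt_cos J k q (pi / 2) = 0.
Proof.
apply: big1 => j _; rewrite (_ : oddn j * (pi / 2) = pi / 2 + pi *+ j); last first.
  by rewrite /oddn -[pi *+ j]mulr_natl -natr1 -muln2 natrM; field.
have -> : cos (pi / 2 + pi *+ j) = (-1) ^+ j * cos (pi / 2) :> R.
  exact: (alternatingn (@cosDpi R)).
by rewrite cos_pihalf !mulr0.
Qed.

(** Real part of a geometric sum of ratio [- q^2 e^{2iv}], cleared of the denominator [|1 + q^2
    e^{2iv}|^2 = (1 - q^2)^2 + 4 q^2 cos^2 v]. *)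
Lemma sum_alt_cosE J q v :
  ((1 - q ^+ 2) ^+ 2 + 4 * q ^+ 2 * cos v ^+ 2) *
    \sum_(j < J) (-1) ^+ j * (q ^+ j.*2 / oddn j ^+ 0) * cos (oddn j * v) =
  (1 + q ^+ 2) * cos v - (-1) ^+ J * q ^+ J.*2 *
    (cos (J.*2%:R * v + v) + q ^+ 2 * cos (J.*2%:R * v - v)).
Proof.
elim: J => [|J IH].
  by rewrite big_ord0 double0 mulr0n mul0r add0r sub0r cosN !expr0; ring.
rewrite big_ord_recr /= mulrDr IH doubleS !exprS expr0 divr1.
have -> : oddn J * v = J.*2%:R * v + v by rewrite /oddn -natr1; ring.
rewrite -!natr1.
have -> : (J.*2%:R + 1 + 1) * v + v = (J.*2%:R * v + v) + v *+ 2 by ring.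
have -> : (J.*2%:R + 1 + 1) * v - v = J.*2%:R * v + v by ring.
have -> : cos (J.*2%:R * v - v) = cos ((J.*2%:R * v + v) - v *+ 2).
  by congr cos; ring.
move: (J.*2%:R * v + v) => a; rewrite cosB (cosD a) cos_mulr2n; ring.
Qed.

(** The full series is [Re arctan (q e^{iv}) = atan (2 q cos v / (1 - q^2)) / 2]. Both terms vanish
    at [q = 0], and their derivatives in [q] differ by the remainder [df] of the geometric sum. *)
Lemma alt_cos1_atan J q0 q v : 0 <= q <= q0 -> q0 < 1 ->
  `|alt_cos J 1 q v - atan (2 * q * cos v / (1 - q ^+ 2)) / 2| <=
  2 * q0 ^+ J.*2 / (1 - q0 ^+ 2) ^+ 2.
Proof.
move=> /andP[q_ge0 qq0] q01; set C := (X in _ <= X).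
pose D t : R := (1 - t ^+ 2) ^+ 2 + 4 * t ^+ 2 * cos v ^+ 2.
pose g t : R := 2 * t * cos v / (1 - t ^+ 2).
pose df t : R := - ((-1) ^+ J * t ^+ J.*2 *
    (cos (J.*2%:R * v + v) + t ^+ 2 * cos (J.*2%:R * v - v))) / D t.
have q0_ge0 : 0 <= q0 by lra.
have pos t : 0 <= t <= q -> 0 < 1 - q0 ^+ 2 <= 1 - t ^+ 2.
  move=> /andP[t0 tq]; rewrite lerD2l lerN2 subr_gt0 expr_lt1 // q01 /=.
  by rewrite lerXn2r ?nnegrE //; lra.
have Dpos t : 0 <= t <= q -> 0 < (1 - q0 ^+ 2) ^+ 2 <= D t.
  move=> /pos/andP[h1 h2]; rewrite exprn_gt0//= /D.
  apply: (@le_trans _ _ ((1 - t ^+ 2) ^+ 2)); first by rewrite lerXn2r ?nnegrE //; lra.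
  by rewrite lerDl -mulrA pmulr_rge0 // -exprMn sqr_ge0.
have gd t : 0 <= t <= q -> is_derive t 1 g
    (2 * cos v * (1 + t ^+ 2) / (1 - t ^+ 2) ^+ 2).
  move=> /pos/andP[h1 h2]; have h : 1 - t ^+ 2 != 0 by rewrite gt_eqF //; lra.
  have d1 : is_derive t 1 (fun u : R => 1 - u ^+ 2) (0 - 2%:R * t ^+ 1 * 1).
    by apply: derive_pointwiseB; exact: derive_pointwiseX.
  have d2 := is_deriveV (f := fun u : R => 1 - u ^+ 2) h d1.
  have d3 := derive_pointwiseM (derive_pointwise_linear (2 * cos v) t) d2.
  have -> : g = fun u : R => 2 * cos v * u * (1 - u ^+ 2)^-1.
    by apply/funext => u; rewrite /g; ring.
  apply: is_derive_eq d3 _.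
  by rewrite /GRing.scale /=; field.
have fd t : 0 <= t <= q ->
    is_derive t 1 (fun u => alt_cos J 1 u v - 2^-1 * atan (g u)) (df t).
  move=> tq; have /andP[h1 h2] := pos _ tq; have /andP[D1 D2] := Dpos _ tq.
  have da := derive_pointwise_comp (is_derive1_atan (g t)) (gd _ tq).
  apply: is_derive_eq
    (derive_pointwiseB (derive_alt_cos_q J 0 t v) (derive_pointwiseZ 2^-1 da)) _.
  have D0 : D t != 0 by rewrite gt_eqF //; lra.
  have h : 1 - t ^+ 2 != 0 by rewrite gt_eqF //; lra.
  have -> : \sum_(j < J) (-1) ^+ j * (t ^+ j.*2 / oddn j ^+ 0) * cos (oddn j * v)
      = ((1 + t ^+ 2) * cos v - (-1) ^+ J * t ^+ J.*2 *
    (cos (J.*2%:R * v + v) + t ^+ 2 * cos (J.*2%:R * v - v))) / D t.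
    by rewrite -sum_alt_cosE -/(D t) mulrAC mulfV // mul1r.
  have -> : (1 + g t ^+ 2)^-1 = (1 - t ^+ 2) ^+ 2 / D t.
    rewrite /g; rewrite -[RHS]invf_div; congr (_^-1).
    by rewrite /D; field.
  by rewrite /df; field; rewrite D0 h.
have bd t : 0 <= t <= q -> `|df t| <= C.
  move=> tq; have /andP[D1 D2] := Dpos _ tq; move/andP: tq => [t0 tq].
  have D3 : 0 < D t by lra.
  rewrite /df /C normrM normfV (gtr0_norm D3).
  apply: ler_pM; rewrite ?invr_ge0 ?(ltW D3) //; last first.
    by rewrite lef_pV2 ?posrE.
  rewrite normrN 2!normrM normrX normrN1 expr1n mul1r [leLHS]mulrC.
  rewrite (@ger0_norm _ (t ^+ J.*2)) ?exprn_ge0 //.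
  apply: ler_pM; rewrite ?exprn_ge0 //; last first.
    by rewrite lerXn2r ?nnegrE //; lra.
  apply: le_trans (ler_normD _ _) _; rewrite normrM.
  have c1 := cos_max (J.*2%:R * v + v); have c2 := cos_max (J.*2%:R * v - v).
  have t21 : t ^+ 2 <= 1 by apply: exprn_ile1; lra.
  rewrite (ger0_norm (sqr_ge0 t)).
  have : t ^+ 2 * `|cos (J.*2%:R * v - v)| <= 1 * 1 by apply: ler_pM; rewrite ?sqr_ge0.
  lra.
have := derive_norm_le q_ge0 fd (fun t _ => derive_pointwise_linear C t) bd.
rewrite alt_cos_q0 /g !mulr0 !mul0r atan0 mulr0 !subr0.
rewrite [2^-1 * _]mulrC => /le_trans; apply.
apply: ler_piMr; last lra.
by apply: divr_ge0; [apply: mulr_ge0|]; rewrite ?sqr_ge0 ?exprn_ge0.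
Qed.


(** The error in [alt_cos1_atan], uniform over arguments in [[0, q]]; for fixed [q < 1] it tends to
    [0] as [J] grows. *)
Definition trunc_err J q : R := 2 * q ^+ J.*2 / (1 - q ^+ 2) ^+ 2.

Lemma trunc_err_ge0 J q : 0 <= q -> 0 <= trunc_err J q.
Proof.
by move=> q0; apply: divr_ge0; [apply: mulr_ge0|]; rewrite ?sqr_ge0 ?exprn_ge0.
Qed.

(** Truncated form of the domination of [v ^ 2]. The second derivative of [alt_cos J 3] in [v] is
    [- alt_cos J 1], at least [- C] because [atan < pi / 2]. It is integrated twice, from [0] where
    [alt_sin] vanishes and from [pi / 2] where [alt_cos] vanishes. *)
Lemma alt_cos3_le J q0 q v : 0 <= q <= q0 -> q0 < 1 -> `|v| <= pi / 2 ->
  alt_cos J 3 q v <= (pi / 4 + trunc_err J q0) / 2 * (pi ^+ 2 / 4 - v ^+ 2).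
Proof.
move=> qq0 q01 vpi; set C := pi / 4 + _.
have [-> ->] : alt_cos J 3 q v = alt_cos J 3 q `|v| /\ v ^+ 2 = `|v| ^+ 2.
  split; last by rewrite real_normK ?num_real.
  by case: (ler0P v) => _ //; rewrite alt_cosN.
move: `|v| vpi (normr_ge0 v) => {}v vpi v0.
have le1 (w : R) : alt_cos J 1 q w <= C.
  have := alt_cos1_atan J w qq0 q01; rewrite -/(trunc_err J q0) ler_norml => /andP[_].
  by have := atan_ltpi2 (2 * q * cos w / (1 - q ^+ 2)); rewrite /C; lra.
have d2 (w : R) : is_derive w 1 (fun u => C * u - alt_sin J 2 q u)
    (C - alt_cos J 1 q w).
  apply: derive_pointwiseB; first exact: derive_pointwise_linear.
  exact: derive_alt_sin_v.
have le2 (w : R) : 0 <= w -> 0 <= C * w - alt_sin J 2 q w.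
  move=> w0; have := @ge0_derive_le _ _ _ 0 w w0 (fun u _ => d2 u).
  by rewrite alt_sin0 mulr0 subr0; apply => u _; rewrite subr_ge0.
have d3 (w : R) : is_derive w 1 (fun u => C / 2 * u ^+ 2 + alt_cos J 3 q u)
    (C * w - alt_sin J 2 q w).
  have h := derive_pointwiseZ (C / 2) (derive_pointwiseX 2 (is_derive_id w 1)).
  apply: is_derive_eq (derive_pointwiseD h (derive_alt_cos_v J 2 q w)) _.
  by rewrite /=; field.
have := @ge0_derive_le _ _ _ v (pi / 2) vpi (fun u _ => d3 u).
rewrite alt_cos_pihalf => h.
have {}h := h (fun u hu => le2 u (le_trans v0 (andP hu).1)).
rewrite mulrBr lerBrDr addrC.
by apply: le_trans h _; rewrite addr0 expr_div_n; lra.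
Qed.

Lemma alt_cos0E J k q : alt_cos J k q 0 =
  \sum_(j < J) (-1) ^+ j * (q ^+ j.*2.+1 / oddn j ^+ k).
Proof. by apply: eq_bigr => j _; rewrite mulr0 cos0 mulr1. Qed.

(** On [[0, 1]] the derivative in [q] is an alternating sum with decreasing terms, hence
    nonnegative. *)
Lemma alt_cos0_le J k q q' : 0 <= q <= q' -> q' <= 1 ->
  alt_cos J k.+1 q 0 <= alt_cos J k.+1 q' 0.
Proof.
move=> /andP[q0 qq'] q'1.
apply: (ge0_derive_le qq' (fun t _ => derive_alt_cos_q J k t 0)) => t /andP[qt tq'].
rewrite (eq_bigr (fun j : 'I_J => (-1) ^+ j * (t ^+ j.*2 / oddn j ^+ k))); last first.
  by move=> j _; rewrite mulr0 cos0 mulr1.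
have t0 : 0 <= t by lra.
have o0 j : 0 <= oddn j by rewrite ltW ?oddn_gt0.
have := @alternating_sum_bounds _ (fun j => t ^+ j.*2 / oddn j ^+ k) J.
case/(_ _ _)/andP => // j; first by rewrite divr_ge0 ?exprn_ge0.
rewrite ler_pM ?invr_ge0 ?exprn_ge0 //.
  by apply: ler_wiXn2l; [lra|lra|lia].
by rewrite lef_pV2 ?posrE ?exprn_gt0 ?oddn_gt0// lerXn2r ?nnegrE ?oddnS.
Qed.

(** The derivative in [t] of the value at [expR (- t)] is minus the sum of exponent one less, which
    is largest at [t = 0]. For [k = 1] this slope is a partial sum of Catalan's series. *)
Lemma alt_cos0_expR_ge J k (s : R) : 0 <= s ->
  alt_cos J k.+2 1 0 - alt_cos J k.+1 1 0 * s <= alt_cos J k.+2 (expR (- s)) 0.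
Proof.
move=> s0; pose f t := alt_cos J k.+2 (expR (- t)) 0 + alt_cos J k.+1 1 0 * t.
pose df t := - alt_cos J k.+1 (expR (- t)) 0 + alt_cos J k.+1 1 0.
have fd t : 0 <= t <= s -> is_derive t 1 f (df t).
  move=> _; have de := derive_pointwise_comp (is_derive_expR (- t)) (is_deriveNid t 1).
  have h := derive_pointwise_comp (g := fun t => expR (- t))
    (derive_alt_cos_q J k.+1 (expR (- t)) 0) de.
  apply: is_derive_eq (derive_pointwiseD h (derive_pointwise_linear _ t)) _.
  rewrite /df mulrN1 mulrN; congr (- _ + _).
  rewrite mulr_suml; apply: eq_bigr => j _; rewrite [expR _ ^+ j.*2.+1]exprS; ring.
have := ge0_derive_le s0 fd; rewrite /f oppr0 expR0 mulr0 addr0 => h.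
rewrite lerBlDr; apply: h => t /andP[t0 _]; rewrite /df addrC subr_ge0.
by apply: alt_cos0_le; rewrite ?expR_ge0 ?lexx //= -expR0 ler_expR; lra.
Qed.

Lemma atan_le_id (y : R) : 0 <= y -> atan y <= y.
Proof.
move=> y0; have fd t : 0 <= t <= y -> is_derive t 1 (fun u => 1 * u - atan u)
    (1 - (1 + t ^+ 2)^-1).
  by move=> _; apply: derive_pointwiseB; exact: derive_pointwise_linear.
have := ge0_derive_le y0 fd; rewrite atan0 mulr0 subrr subr_ge0 mul1r; apply.
by move=> t _; rewrite subr_ge0 invf_le1 ?lerDl ?sqr_ge0 // ltr_pwDl ?sqr_ge0.
Qed.

(** Follows from [atan x^-1 = pi / 2 - atan x] and [atan y <= y]. *)
Lemma atan_ge_pihalf_subV (x : R) : 0 < x -> pi / 2 - x^-1 <= atan x.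
Proof.
move=> x0; suff aE : atan x^-1 = pi / 2 - atan x.
  by have := @atan_le_id x^-1; rewrite invr_ge0 aE ltW // => /(_ isT); lra.
have a0 : 0 < atan x by rewrite -(@atan0 R) lt_atan.
have := atan_ltpi2 x => a2.
rewrite -[RHS]tanK; last by rewrite in_itv /=; apply/andP; split; lra.
congr atan; rewrite -{1}[x]atanK /tan invf_div.
by rewrite sinB cosB sin_pihalf cos_pihalf !mul0r !mul1r subr0 add0r.
Qed.

End PartialSums.

(** * Lower bounds at [v = 0] and the passage to Catalan's constant *)

Section LowerBound.
Context {R : realType}.
Implicit Types (q v : R) (J k : nat).

(** The double integration of [alt_cos3_le], with the opposite bound on the second derivative. *)
Lemma alt_cos3_sub_ge J q (c a b : R) : 0 <= a <= b ->
  (forall w, 0 <= w <= b -> c <= alt_cos J 1 q w) ->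
  c / 2 * (b ^+ 2 - a ^+ 2) <= alt_cos J 3 q a - alt_cos J 3 q b.
Proof.
move=> /andP[a0 ab] hc.
have d2 (w : R) :
    is_derive w 1 (fun u => alt_sin J 2 q u - c * u) (alt_cos J 1 q w - c).
  by apply: derive_pointwiseB; [exact: derive_alt_sin_v|exact: derive_pointwise_linear].
have le2 (w : R) : 0 <= w <= b -> 0 <= alt_sin J 2 q w - c * w.
  move=> /andP[w0 wb]; have := @ge0_derive_le _ _ _ 0 w w0 (fun u _ => d2 u).
  rewrite alt_sin0 mulr0 subr0; apply => u /andP[u0 uw].
  by rewrite subr_ge0 hc // u0 (le_trans uw).
have d3 (w : R) : is_derive w 1 (fun u => - (c / 2) * u ^+ 2 - alt_cos J 3 q u)
    (alt_sin J 2 q w - c * w).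
  have h := derive_pointwiseZ (- (c / 2)) (derive_pointwiseX 2 (is_derive_id w 1)).
  apply: is_derive_eq (derive_pointwiseB h (derive_alt_cos_v J 2 q w)) _.
  by rewrite /=; field.
have := @ge0_derive_le _ _ _ a b ab (fun u _ => d3 u).
have hu u : a <= u <= b -> 0 <= alt_sin J 2 q u - c * u.
  by move=> /andP[au ub]; apply: le2; rewrite (le_trans a0 au) ub.
by move=> /(_ hu); lra.
Qed.

(** As [q] tends to [1] the arctangent tends to [pi / 2] where the cosine stays above [x > 0];
    [atan_ge_pihalf_subV] gives the rate. *)
Lemma alt_cos1_ge J q (v x : R) : 0 < q < 1 -> 0 < x <= cos v ->
  pi / 4 - (1 - q ^+ 2) / (4 * q * x) - trunc_err J q <= alt_cos J 1 q v.
Proof.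
move=> /andP[q0 q1] /andP[x0 xv].
have q2 : 0 < 1 - q ^+ 2 by rewrite subr_gt0 expr_lt1 //; lra.
have qq : 0 <= q <= q by rewrite lexx ltW.
have := alt_cos1_atan J v qq q1.
rewrite -/(trunc_err J q) ler_norml => /andP[h _].
have h1 : 0 < 2 * q * x / (1 - q ^+ 2) by rewrite divr_gt0 // !mulr_gt0.
have h2 : atan (2 * q * x / (1 - q ^+ 2)) <= atan (2 * q * cos v / (1 - q ^+ 2)).
  apply: le_atan; rewrite ler_pM2r ?invr_gt0 // ler_pM2l // mulr_gt0 //.
have := atan_ge_pihalf_subV h1; rewrite invf_div.
have -> : (1 - q ^+ 2) / (2 * q * x) = 2 * ((1 - q ^+ 2) / (4 * q * x)).
  by field; rewrite !gt_eqF.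
lra.
Qed.

(** Serves near [v = pi / 2], where the cosine has no positive lower bound but the arctangent is
    still nonnegative. *)
Lemma alt_cos1_ge_trunc_err J q v : 0 < q < 1 -> `|v| <= pi / 2 ->
  - trunc_err J q <= alt_cos J 1 q v.
Proof.
move=> /andP[q0 q1]; rewrite ler_norml => /cos_ge0_pihalf cv.
have qq : 0 <= q <= q by rewrite lexx ltW.
have := alt_cos1_atan J v qq q1.
rewrite -/(trunc_err J q) ler_norml => /andP[h _].
suff : 0 <= atan (2 * q * cos v / (1 - q ^+ 2)) by lra.
have q2 : 0 < 1 - q ^+ 2 by rewrite subr_gt0 expr_lt1 //; lra.
by rewrite -[leLHS]atan0; apply: le_atan;
  rewrite divr_ge0 ?(ltW q2) // !mulr_ge0 // ltW.
Qed.

(** As [J] grows, then [q] tends to [1] and [d] to [0], the bound tends to [pi^3 / 32], the value of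
    [sum_j (-1)^j / (2j+1)^3]. The interval is split at [pi / 2 - d]: before it the cosine is at
    least [sin d], after it the crude bound suffices. *)
Lemma alt_cos3_0_ge J q d : 0 < q < 1 -> 0 < d < pi / 2 ->
  (pi / 4 - (1 - q ^+ 2) / (4 * q * sin d) - trunc_err J q) / 2 *
    (pi / 2 - d) ^+ 2 - trunc_err J q / 2 * (pi / 2) ^+ 2 <= alt_cos J 3 q 0.
Proof.
move=> q01 d0; set e := trunc_err J q; have e0 : 0 <= e.
  by apply: trunc_err_ge0; case/andP: q01 => /ltW.
have sd : 0 < sin d by apply: sin_gt0_pi; have := pi_gt0 R; lra.
have sdc w : 0 <= w <= pi / 2 - d -> sin d <= cos w.
  move=> hw; have -> : sin d = cos (pi / 2 - d).
    by rewrite cosB cos_pihalf sin_pihalf mul0r add0r mul1r.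
  have pi0 := pi_gt0 R.
  by rewrite leNgt ltr_cos ?in_itv /= -?leNgt; lra.
have d1 : 0 <= pi / 2 - d <= pi / 2 by lra.
have d2 : (0 : R) <= 0 <= pi / 2 - d by rewrite lexx; lra.
have h1 := @alt_cos3_sub_ge J q (- e) _ _ d1.
have {}h1 : - e / 2 * ((pi / 2) ^+ 2 - (pi / 2 - d) ^+ 2) <=
    alt_cos J 3 q (pi / 2 - d) - alt_cos J 3 q (pi / 2).
  apply: h1 => w /andP[w0 wpi]; apply: alt_cos1_ge_trunc_err => //.
  by rewrite ger0_norm.
have h2 := @alt_cos3_sub_ge J q _ _ _ d2
  (fun w hw => alt_cos1_ge J q01 (introT andP (conj sd (sdc w hw)))).
move: h1 h2; rewrite alt_cos_pihalf -/e.
have : 0 <= e * (pi / 2 - d) ^+ 2 by rewrite mulr_ge0 ?sqr_ge0.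
move=> h3 h1 h2.
lra.
Qed.

Lemma cvg_trunc_err q : 0 <= q < 1 -> (trunc_err ^~ q @ \oo --> 0)%classic.
Proof.
move=> /andP[q0 q1]; have h : `|q ^+ 2| < 1 by rewrite ger0_norm ?sqr_ge0 ?expr_lt1.
have := cvg_geometric (2 / (1 - q ^+ 2) ^+ 2) h.
rewrite (_ : geometric _ _ = trunc_err ^~ q) //; apply/funext => J.
by rewrite /trunc_err /= -mul2n exprM; ring.
Qed.

Lemma catalanE J : series (fun j : nat => (-1) ^+ j / (j.*2.+1)%:R ^+ 2 : R) J =
  alt_cos J 2 1 0.
Proof.
by rewrite alt_cos0E /series /= big_mkord; apply: eq_bigr => j _; rewrite expr1n mul1r.
Qed.

Lemma cvg_alt_cos_catalan :
  ((fun J => alt_cos J 2 1 (0 : R)) @ \oo --> catalan R)%classic.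
Proof.
have -> : (fun J => alt_cos J 2 1 (0 : R)) =
    series (fun j : nat => (-1) ^+ j / (j.*2.+1)%:R ^+ 2 : R).
  by apply/funext => J; rewrite catalanE.
exact: is_cvg_catalan.
Qed.

Lemma alt_cos_catalan_ge0 J : 0 <= alt_cos J 2 1 (0 : R).
Proof.
rewrite alt_cos0E.
have := @alternating_sum_bounds _ (fun j => 1 ^+ j.*2.+1 / (oddn j : R) ^+ 2) J.
have o0 j : 0 <= (oddn j : R) by rewrite ltW ?oddn_gt0.
case/(_ _ _)/andP => // j; rewrite !expr1n !mul1r ?invr_ge0 ?exprn_ge0 //.
by rewrite lef_pV2 ?posrE ?exprn_gt0 ?oddn_gt0// lerXn2r ?nnegrE ?oddnS.
Qed.

Lemma catalan_ge0 : 0 <= catalan R.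
Proof.
apply: limr_ge; first exact: is_cvg_catalan.
by near=> J; rewrite catalanE alt_cos_catalan_ge0.
Unshelve. all: by end_near. Qed.

Lemma le_of_affine_le (x y z b : R) : 0 < b ->
  (forall t, 0 < t < b -> x <= y + z * t) -> x <= y.
Proof.
move=> b0 h; apply/ler_addgt0Pr => e e0.
have z1 : 0 < `|z| + 1 by rewrite ltr_wpDl.
pose t := Num.min (b / 2) (e / (`|z| + 1)).
have t0 : 0 < t by rewrite lt_min !divr_gt0.
have tb : t < b by rewrite gt_min; apply/orP; left; lra.
apply: le_trans (h t _) _; first by rewrite t0.
rewrite lerD2l; apply: (@le_trans _ _ (`|z| * t)).
  by rewrite ler_wpM2r ?ler_norm // ltW.
apply: (@le_trans _ _ ((`|z| + 1) * (e / (`|z| + 1)))).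
  by rewrite ler_pM ?(ltW t0) ?lerDl // ge_min lexx orbT.
by rewrite mulrCA mulfV ?gt_eqF // mulr1.
Qed.

(* [sigma] stands for [(pi / (2 * V)) ^+ 2 * S] and [s] for [pi / (2 * V) * M],
   where [S] is the sum of the squared moduli and [V] the sup norm. *)
Lemma catalan_bound (sigma s : R) : 0 <= s ->
  (forall J q, 0 < q < 1 ->
    alt_cos J 3 (q * expR (- s)) 0 <=
     (pi / 4 + trunc_err J q) / 2 * (pi ^+ 2 / 4 - sigma / 2)) ->
  pi / 16 * sigma <= catalan R * s.
Proof.
move=> s0 H.
have step (q d : R) : 0 < q < 1 -> 0 < d < pi / 2 ->
    pi / 16 * sigma <= catalan R * (s - ln q) + pi ^+ 2 / 8 * d
      + pi ^+ 2 / 8 * ((1 - q ^+ 2) / (4 * q * sin d)).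
  move=> q01 d01; set k := (1 - q ^+ 2) / _.
  have /andP[q0 q1] := q01.
  have k0 : 0 <= k.
    apply: divr_ge0; first by rewrite subr_ge0 exprn_ile1 // ltW.
    have sd : 0 < sin d by apply: sin_gt0_pi; have := pi_gt0 R; lra.
    by rewrite !mulr_ge0 // ltW.
  have lq : 0 <= s - ln q by have := ln_lt0 q01; lra.
  pose C : R := catalan R.
  pose g (e G : R) := (pi / 4 + e) / 2 * (pi ^+ 2 / 4 - sigma / 2) + G * (s - ln q)
    + e / 2 * (pi / 2 - d) ^+ 2 + e / 2 * (pi / 2) ^+ 2.
  (* The chain: the value at [q] from below, monotonicity up to [1], descent to
     [expR (- (s - ln q)) = q * expR (- s)] with Catalan slope, and [H] from above. *)
  have gJ J : (pi / 4 - k) / 2 * (pi / 2 - d) ^+ 2 <=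
      g (trunc_err J q) (alt_cos J 2 1 0).
    have h1 := alt_cos3_0_ge J q01 d01.
    have h2 : alt_cos J 3 q 0 <= alt_cos J 3 1 0 by apply: alt_cos0_le; lra.
    have h3 := alt_cos0_expR_ge J 1 lq.
    have h4 := H J q q01.
    have : expR (- (s - ln q)) = q * expR (- s).
      by rewrite opprB expRD lnK ?posrE.
    by move=> h5; move: h3; rewrite h5 /g -/k; move: h1; rewrite -/k; lra.
  (* Letting [J] grow removes the truncation errors and turns the partial sums into [catalan R]. *)
  have gl : ((fun J => g (trunc_err J q) (alt_cos J 2 1 0)) @ \oo --> g 0 C)%classic.
    have e0 := @cvg_trunc_err q; have {}e0 : (trunc_err ^~ q @ \oo --> 0)%classic.
      by apply: e0; lra.
    rewrite /g; apply: cvgD; last by apply: cvgMr_tmp; apply: cvgMr_tmp.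
    apply: cvgD; last by apply: cvgMr_tmp; apply: cvgMr_tmp.
    apply: cvgD; last by apply: cvgMr_tmp; exact: cvg_alt_cos_catalan.
    by apply: cvgMr_tmp; apply: cvgMr_tmp; apply: cvgD => //; exact: cvg_cst.
  have : (pi / 4 - k) / 2 * (pi / 2 - d) ^+ 2 <= g 0 C.
    rewrite -(cvg_lim _ gl) //; apply: limr_ge; first exact: cvgP gl.
    by near=> J; exact: gJ.
  rewrite /g -/C.
  have p0 := pi_gt0 R.
  (* Once the square is expanded, [pi^3 / 32] occurs on both sides and cancels; [h6] and [h7]
     control the rest. *)
  have h6 : k * (pi / 2 - d) ^+ 2 <= k * (pi ^+ 2 / 4).
    rewrite ler_wpM2l // (_ : pi ^+ 2 / 4 = (pi / 2) ^+ 2); last by field.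
    by rewrite lerXn2r ?nnegrE; lra.
  have h7 : 0 <= pi / 8 * d ^+ 2 by rewrite mulr_ge0 ?sqr_ge0 //; lra.
  lra.
have p2 : 0 < pi / 2 :> R by rewrite divr_gt0 ?pi_gt0.
(* The limit in [t], with [q = 1 - t], is taken at fixed [d], since its slope contains [1 / sin d].
   The range [t < 1 / 2] yields [t / (1 - t) <= 2 * t]. *)
apply: (@le_of_affine_le _ _ (pi ^+ 2 / 8) _ p2) => d d01.
have sd : 0 < sin d by apply: sin_gt0_pi; lra.
apply: (@le_of_affine_le _ _ (2 * catalan R + pi ^+ 2 / 8 / sin d) (2^-1)) => // t t01.
have q01 : 0 < 1 - t < 1 by lra.
apply: le_trans (step _ _ q01 d01) _.
have tq : t / (1 - t) <= 2 * t by rewrite ler_pdivrMr; nra.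
have lq : - ln (1 - t) <= 2 * t.
  apply: le_trans tq; rewrite -lnV ?posrE; last by lra.
  have -> : t / (1 - t) = (1 - t)^-1 - 1 by field; rewrite gt_eqF; lra.
  rewrite -[X in ln X](subrK 1) addrC; apply: le_ln1Dx.
  by rewrite ltrBrDr addNr invr_gt0; lra.
have kt : (1 - (1 - t) ^+ 2) / (4 * (1 - t) * sin d) <= t / sin d.
  rewrite invfM mulrA ler_pM2r ?invr_gt0 // ler_pdivrMr; nra.
have h1 : catalan R * - ln (1 - t) <= catalan R * (2 * t).
  by rewrite ler_wpM2l ?catalan_ge0.
have h2 : pi ^+ 2 / 8 * ((1 - (1 - t) ^+ 2) / (4 * (1 - t) * sin d)) <=
    pi ^+ 2 / 8 * (t / sin d).
  by rewrite ler_wpM2l // divr_ge0 ?sqr_ge0.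
have -> : (2 * catalan R + pi ^+ 2 / 8 / sin d) * t =
  catalan R * (2 * t) + pi ^+ 2 / 8 * (t / sin d) by ring.
lra.
Unshelve. all: by end_near.
Qed.
End LowerBound.

(** * Taylor remainder of the complex exponential, in real and imaginary parts *)

Section ComplexExponential.
Context {R : realType}.
Implicit Types (w z : R[i]).

Lemma complex_ReD w z : complex.Re (w + z) = complex.Re w + complex.Re z.
Proof. by case: w z => ? ? []. Qed.

Lemma complex_Re_sum (I : Type) (r : seq I) (P : pred I) (F : I -> R[i]) :
  complex.Re (\sum_(i <- r | P i) F i) = \sum_(i <- r | P i) complex.Re (F i).
Proof. exact: (big_morph _ complex_ReD erefl). Qed.

Lemma complex_ReM w z : complex.Re (w * z) =
  complex.Re w * complex.Re z - complex.Im w * complex.Im z.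
Proof. by case: w z => ? ? []. Qed.

Lemma complex_ImM w z : complex.Im (w * z) =
  complex.Re w * complex.Im z + complex.Im w * complex.Re z.
Proof. by case: w z => ? ? []. Qed.

Lemma factS_inv (k : nat) : k.+1%:R / k.+1`!%:R = (k`!%:R)^-1 :> R.
Proof.
rewrite factS natrM invfM mulrA mulfV ?mul1r // pnatr_eq0.
Qed.

(** Differentiation shifts [u]. With [u k] the real or imaginary part of [w ^+ k], the shift is
    multiplication by [w]. *)
Lemma derive_exp_sum (u : nat -> R) K (s : R) :
  is_derive s 1 (fun t => \sum_(k < K.+1) t ^+ k * u k / k`!%:R)
    (\sum_(k < K) s ^+ k * u k.+1 / k`!%:R).
Proof.
have -> : (fun t : R => \sum_(k < K.+1) t ^+ k * u k / k`!%:R) =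
    fun t => u 0%N + \sum_(k < K) u k.+1 / k.+1`!%:R * t ^+ k.+1.
  apply/funext => t; rewrite big_ord_recl /= expr0 mul1r fact0 divr1; congr (_ + _).
  by apply: eq_bigr => k _; rewrite /bump /= add1n; ring.
rewrite -[X in is_derive _ _ _ X]add0r; apply: derive_pointwiseD.
apply: derive_pointwise_sum => k.
apply: is_derive_eq (derive_pointwiseZ _ (derive_pointwiseX k.+1 (is_derive_id s 1))) _.
by rewrite /= -(factS_inv k); ring.
Qed.

(* The real and imaginary parts of the Taylor remainder of order [K] of
   [s |-> exp (s w)] satisfy [r_{K+1}' = w r_K], hence the factor [2 A]. *)
Lemma exp_taylor w (A : R) (K : nat) (s : R) :
  `|complex.Re w| <= A -> `|complex.Im w| <= A -> 0 <= s <= 1 ->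
  `|expR (s * complex.Re w) * cos (s * complex.Im w) -
    \sum_(k < K) s ^+ k * complex.Re (w ^+ k) / k`!%:R| <=
    expR A * ((2 * A) ^+ K * s ^+ K / K`!%:R) /\
  `|expR (s * complex.Re w) * sin (s * complex.Im w) -
    \sum_(k < K) s ^+ k * complex.Im (w ^+ k) / k`!%:R| <=
    expR A * ((2 * A) ^+ K * s ^+ K / K`!%:R).
Proof.
set a := complex.Re w; set b := complex.Im w => aA bA.
have A0 : 0 <= A := le_trans (normr_ge0 _) aA.
elim: K s => [|K IH] s /andP[s0 s1].
  rewrite !big_ord0 !subr0 !expr0 fact0 divr1 !mulr1 !normrM !(ger0_norm (expR_ge0 _)).
  have eA : expR (s * a) <= expR A.
    rewrite ler_expR; apply: le_trans (ler_norm _) _; rewrite normrM (ger0_norm s0).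
    rewrite -[leRHS]mul1r; exact: ler_pM.
  by split; rewrite -[leRHS]mulr1; apply: ler_pM; rewrite ?expR_ge0 ?cos_max ?sin_max.
pose X K t := expR (t * a) * cos (t * b) -
  \sum_(k < K) t ^+ k * complex.Re (w ^+ k) / k`!%:R.
pose Y K t := expR (t * a) * sin (t * b) -
  \sum_(k < K) t ^+ k * complex.Im (w ^+ k) / k`!%:R.
have db (c t : R) : is_derive t 1 (fun t : R => t * c) c.
  by under eq_fun do rewrite mulrC; exact: derive_pointwise_linear.
have de (t : R) : is_derive t 1 (fun t => expR (t * a)) (expR (t * a) * a).
  exact: (derive_pointwise_comp (g := fun t => t * a) (is_derive_expR _) (db a t)).
have Xd (t : R) : is_derive t 1 (X K.+1) (a * X K t - b * Y K t).
  have dc := derive_pointwise_comp (g := fun t => t * b) (is_derive_cos _) (db b t).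
  have h := derive_pointwiseB (derive_pointwiseM (de t) dc)
    (derive_exp_sum (fun k => complex.Re (w ^+ k)) K t).
  apply: is_derive_eq h _; rewrite /X /Y.
  have -> : \sum_(k < K) t ^+ k * complex.Re (w ^+ k.+1) / k`!%:R =
      a * \sum_(k < K) t ^+ k * complex.Re (w ^+ k) / k`!%:R -
      b * \sum_(k < K) t ^+ k * complex.Im (w ^+ k) / k`!%:R.
    rewrite !mulr_sumr -sumrB; apply: eq_bigr => k _.
    by rewrite exprS complex_ReM -/a -/b; ring.
  by ring.
have Yd (t : R) : is_derive t 1 (Y K.+1) (b * X K t + a * Y K t).
  have dc := derive_pointwise_comp (g := fun t => t * b) (is_derive_sin _) (db b t).
  have h := derive_pointwiseB (derive_pointwiseM (de t) dc)
    (derive_exp_sum (fun k => complex.Im (w ^+ k)) K t).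
  apply: is_derive_eq h _; rewrite /X /Y.
  have -> : \sum_(k < K) t ^+ k * complex.Im (w ^+ k.+1) / k`!%:R =
      b * \sum_(k < K) t ^+ k * complex.Re (w ^+ k) / k`!%:R +
      a * \sum_(k < K) t ^+ k * complex.Im (w ^+ k) / k`!%:R.
    rewrite !mulr_sumr -big_split; apply: eq_bigr => k _.
    by rewrite exprS complex_ImM -/a -/b /=; ring.
  by ring.
have X0 : X K.+1 0 = 0.
  rewrite /X !mul0r expR0 cos0 big_ord_recl big1 /=.
    by rewrite fact0; field.
  by move=> k _; rewrite /bump /= add1n exprS !mul0r.
have Y0 : Y K.+1 0 = 0.
  rewrite /Y !mul0r expR0 sin0 big_ord_recl big1 /=.
    by rewrite fact0; field.
  by move=> k _; rewrite /bump /= add1n exprS !mul0r.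
pose g t : R := expR A * ((2 * A) ^+ K.+1 / K.+1`!%:R) * t ^+ K.+1.
have gd (t : R) : is_derive t 1 g (2 * A * (expR A * ((2 * A) ^+ K * t ^+ K / K`!%:R))).
  apply: is_derive_eq (derive_pointwiseZ _ (derive_pointwiseX K.+1 (is_derive_id t 1))) _.
  by rewrite /= -(factS_inv K) exprS; ring.
have gE : expR A * ((2 * A) ^+ K.+1 * s ^+ K.+1 / K.+1`!%:R) = g s - g 0.
  by rewrite /g [0 ^+ _]exprS; ring.
have bound (x y B : R) : `|x| <= B -> `|y| <= B ->
    `|a * x - b * y| <= 2 * A * B /\ `|b * x + a * y| <= 2 * A * B.
  move=> xB yB; have mb (c z : R) : `|c| <= A -> `|z| <= B -> `|c * z| <= A * B.
    by move=> *; rewrite normrM ler_pM.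
  split; [apply: le_trans (ler_normB _ _) _ | apply: le_trans (ler_normD _ _) _].
    by have := mb _ _ aA xB; have := mb _ _ bA yB; lra.
  by have := mb _ _ bA xB; have := mb _ _ aA yB; lra.
have IHb t : 0 <= t <= s -> 0 <= t <= 1 by move=> /andP[-> /le_trans]; apply.
have hX : `|X K.+1 s - X K.+1 0| <= g s - g 0.
  apply: (derive_norm_le s0 (fun t _ => Xd t) (fun t _ => gd t)) => t /IHb/IH[x y].
  by have [] := bound _ _ _ x y.
have hY : `|Y K.+1 s - Y K.+1 0| <= g s - g 0.
  apply: (derive_norm_le s0 (fun t _ => Yd t) (fun t _ => gd t)) => t /IHb/IH[x y].
  by have [] := bound _ _ _ x y.
by rewrite gE; split; [rewrite X0 subr0 in hX|rewrite Y0 subr0 in hY].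
Qed.

End ComplexExponential.

(** * Exact averages of trigonometric polynomials over roots of unity *)

Section RootsOfUnity.
Context {R : realType}.
Implicit Types (x y t : R).

Lemma expi0 : expi (0 : R) = 1.
Proof. by rewrite /expi cos0 sin0. Qed.

Lemma expiD x y : expi (x + y) = expi x * expi y.
Proof. by rewrite /expi cosD sinD; congr Complex; ring. Qed.

Lemma expi_natmul (n : nat) x : expi (n%:R * x) = expi x ^+ n.
Proof.
elim: n => [|n IH]; first by rewrite mul0r expi0.
by rewrite exprS -IH -expiD -natr1; congr expi; ring.
Qed.

Lemma expi_mul_conj x : expi x * (expi x)^*%C = 1.
Proof.
by rewrite /expi -[RHS]/(1 +i* 0)%C -(cos2Dsin2 x); congr Complex; ring.
Qed.

Lemma conjcM (w z : R[i]) : (w * z)^*%C = w^*%C * z^*%C.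
Proof. exact: rmorphM. Qed.

Lemma conjcX (z : R[i]) k : (z ^+ k)^*%C = z^*%C ^+ k.
Proof. exact: rmorphXn. Qed.

Definition unity_root (Q : nat) : R[i] := expi (pi *+ 2 / Q%:R).

Lemma unity_root_expr Q : (0 < Q)%N -> unity_root Q ^+ Q = 1.
Proof.
move=> Q0; rewrite -expi_natmul mulrC divfK ?pnatr_eq0 -?lt0n //.
by rewrite /expi cos2pi sin2pi.
Qed.

(** The real part is [1 - 2 sin^2 x] with [x = i pi / Q] strictly between [0] and [pi]. *)
Lemma unity_root_expr_neq1 Q i : (0 < i < Q)%N -> unity_root Q ^+ i != 1.
Proof.
move=> /andP[i0 iQ]; have Q0 : 0 < Q%:R :> R by rewrite ltr0n (leq_trans _ iQ).
rewrite -expi_natmul; pose x : R := i%:R * pi / Q%:R.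
have -> : i%:R * (pi *+ 2 / Q%:R) = x *+ 2 :> R by rewrite /x; ring.
have : 0 < sin x.
  apply: sin_gt0_pi; rewrite /x divr_gt0 //= ?mulr_gt0 ?pi_gt0 ?(ltr0n R i) //.
  by rewrite ltr_pdivrMr // mulrC ltr_pM2l ?pi_gt0 // ltr_nat.
move=> s0; apply/eqP => /(congr1 (@complex.Re R)).
rewrite /= cos_mulr2n cos2sin2 => h.
have : 0 < sin x ^+ 2 by rewrite exprn_gt0.
have -> : sin x ^+ 2 = 0 by move: h => /=; lra.
by rewrite ltxx.
Qed.

Lemma unity_root_expr_inj Q i j : (i < Q)%N -> (j < Q)%N ->
  unity_root Q ^+ i = unity_root Q ^+ j -> i = j.
Proof.
wlog ij : i j / (i <= j)%N => [H|].
  by case: (leqP i j) => [ij|/ltnW ij] iQ jQ e; [exact: H|apply/esym/H].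
move=> iQ jQ; rewrite -{1}(subnK ij) exprD => e.
have z0 : unity_root Q ^+ i != 0.
  apply: contraTneq isT => z0.
  have := @unity_root_expr Q (leq_ltn_trans (leq0n _) iQ).
  by rewrite -{2}(subnK (ltnW iQ)) exprD z0 mulr0 => /eqP; rewrite eq_sym oner_eq0.
have e1 : unity_root Q ^+ (j - i) = 1.
  by apply: (mulIf z0); rewrite mul1r -exprD subnK // e -exprD subnK.
apply/eqP; rewrite eqn_leq ij /= -subn_eq0; apply: contraTT isT; rewrite -lt0n => ji.
have jiQ := leq_ltn_trans (leq_subr i j) jQ.
by move: (@unity_root_expr_neq1 Q (j - i)); rewrite ji e1 eqxx jiQ => /(_ isT).
Qed.

Lemma sum_expr_root_eq0 (F : fieldType) (z : F) Q : z ^+ Q = 1 -> z != 1 ->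
  \sum_(l < Q) z ^+ l = 0.
Proof.
move=> zQ z1; have /eqP := subrX1 z Q; rewrite zQ subrr eq_sym mulf_eq0 subr_eq0.
by rewrite (negPf z1) => /eqP.
Qed.

(** Discrete mean value property: each monomial of degree strictly between [0] and [Q] sums to zero,
    being a full geometric sum of a root of unity other than [1]. *)
Lemma sum_horner_unity_root Q (r : {poly R[i]}) : (0 < Q)%N -> (size r <= Q)%N ->
  \sum_(l < Q) r.[unity_root Q ^+ l] = Q%:R * r.[0].
Proof.
move=> Q0 rQ; under eq_bigr do rewrite (horner_coef_wide _ rQ).
rewrite exchange_big /= horner_coef0 (bigD1 (Ordinal Q0)) //= [X in _ + X]big1.
  rewrite addr0; under eq_bigr do rewrite expr0 mulr1.
  by rewrite sumr_const card_ord mulr_natl.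
move=> i i0; rewrite -mulr_sumr; under eq_bigr do rewrite -exprM mulnC exprM.
rewrite sum_expr_root_eq0 ?mulr0 //;
  first by rewrite -exprM mulnC exprM unity_root_expr ?expr1n.
by rewrite unity_root_expr_neq1 // ltn_ord andbT lt0n.
Qed.

Variables (N : nat) (n : 'I_N -> nat) (a : 'I_N -> R[i]).

Definition node Q (l : nat) : R := l%:R * (pi *+ 2 / Q%:R).

Definition poly_of_trig : {poly R[i]} := \sum_(k < N) a k *: 'X^(n k).

Lemma trig_poly_node Q l :
  trig_poly n a (node Q l) = poly_of_trig.[unity_root Q ^+ l].
Proof.
rewrite horner_sum; apply: eq_bigr => k _.
by rewrite hornerZ hornerXn !expi_natmul.
Qed.

Hypothesis n_pos : forall k, (0 < n k)%N.
Let D := (\max_(k < N) n k)%N.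

Lemma size_poly_of_trig : (size poly_of_trig <= D.+1)%N.
Proof.
apply: (leq_trans (size_sum _ _ _)); apply/bigmax_leqP => k _.
apply: (leq_trans (size_scale_leq _ _)); rewrite size_polyXn ltnS.
exact: leq_bigmax.
Qed.

Lemma poly_of_trig_at0 : poly_of_trig.[0] = 0.
Proof.
rewrite horner_sum big1 // => k _.
by rewrite hornerZ hornerXn expr0n gtn_eqF // mulr0.
Qed.

(** The [k]-th power is a polynomial in [e^{ix}] of degree at most [k * D], without constant term
    because all frequencies are positive. *)
Lemma sum_trig_poly_expr Q k : (0 < k)%N -> (k * D < Q)%N ->
  \sum_(l < Q) trig_poly n a (node Q l) ^+ k = 0.
Proof.
move=> k0 kQ; under eq_bigr do rewrite trig_poly_node -horner_exp.
rewrite sum_horner_unity_root ?(leq_ltn_trans _ kQ) //.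
  by rewrite horner_exp poly_of_trig_at0 expr0n gtn_eqF ?mulr0.
apply: (leq_trans (size_poly_exp_leq _ _));
rewrite (leq_ltn_trans _ kQ) // mulnC leq_mul2l.
have := size_poly_of_trig.
by case: size => [|m]; rewrite ?orbT // ltnS => ->; rewrite orbT.
Qed.

(** Distinct frequencies below [Q] stay distinct modulo [Q], so the off-diagonal terms of the double
    sum in the next lemma vanish. *)
Hypothesis n_inj : injective n.

Lemma sum_trig_poly_parseval Q : (D < Q)%N ->
  \sum_(l < Q) trig_poly n a (node Q l) * (trig_poly n a (node Q l))^*%C =
  Q%:R * \sum_(k < N) a k * (a k)^*%C.
Proof.
move=> DQ; have Q0 : (0 < Q)%N by exact: leq_ltn_trans DQ.
have nQ k : (n k < Q)%N by apply: leq_ltn_trans DQ; exact: leq_bigmax.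
have zz : unity_root Q * (unity_root Q)^*%C = 1 by exact: expi_mul_conj.
(* This is the root of unity to the power [n j - n k], with the conjugate as inverse. *)
pose u j k := unity_root Q ^+ n j * (unity_root Q)^*%C ^+ n k.
have E l : trig_poly n a (node Q l) * (trig_poly n a (node Q l))^*%C =
    \sum_(j < N) \sum_(k < N) a j * (a k)^*%C * u j k ^+ l.
  rewrite /trig_poly rmorph_sum /= mulr_suml; apply: eq_bigr => j _.
  rewrite mulr_sumr; apply: eq_bigr => k _.
  rewrite conjcM !expi_natmul -exprM conjcX -[expi _]/(unity_root Q) conjcX.
  rewrite /u exprMn -!exprM.
  by rewrite (mulnC (n j)) (mulnC (n k)) !exprM; ring.
under eq_bigr do rewrite E.
rewrite exchange_big /= mulr_sumr; apply: eq_bigr => j _.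
rewrite exchange_big /= (bigD1 j) //= [X in _ + X]big1.
  rewrite addr0 /u -exprMn zz expr1n; under eq_bigr do rewrite expr1n mulr1.
  by rewrite sumr_const card_ord mulr_natl.
move=> k kj; rewrite -mulr_sumr sum_expr_root_eq0 ?mulr0 //.
  rewrite /u exprMn -!exprM (mulnC (n j)) (mulnC (n k)) !exprM -conjcX.
  by rewrite unity_root_expr // conjc1 !expr1n mulr1.
apply: contraNneq kj => e; apply/eqP/n_inj/esym/(@unity_root_expr_inj Q) => //.
have -> : unity_root Q ^+ n k = unity_root Q ^+ n k * 1 by rewrite mulr1.
by rewrite -e /u mulrCA -exprMn zz expr1n mulr1.
Qed.

Lemma normc_sqr (z : R[i]) : cabs z ^+ 2 = complex.Re (z * z^*%C).
Proof.
case: z => x y; rewrite /cabs /= sqr_sqrtr ?addr_ge0 ?sqr_ge0 //.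
by rewrite mulrN opprK !expr2.
Qed.

(** Since [(Im z)^2 = (|z|^2 - Re z^2) / 2], Parseval gives the first part, and the square of the
    polynomial averages to zero. *)
Lemma sum_Im_trig_poly_sqr Q : (2 * D < Q)%N ->
  \sum_(l < Q) complex.Im (trig_poly n a (node Q l)) ^+ 2 =
  Q%:R * ((\sum_(k < N) cabs (a k) ^+ 2) / 2).
Proof.
move=> DQ; have h2 := sum_trig_poly_expr (isT : 0 < 2)%N DQ.
have DQ' : (D < Q)%N by apply: leq_ltn_trans DQ; rewrite leq_pmull.
have h1 := sum_trig_poly_parseval DQ'.
have E (z : R[i]) : complex.Im z ^+ 2 =
    2^-1 * complex.Re (z * z^*%C) - 2^-1 * complex.Re (z ^+ 2).
  by case: z => x y; rewrite expr2 /=; field.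
under eq_bigr do rewrite E.
rewrite sumrB -!mulr_sumr -!complex_Re_sum h1 h2 mulr0 subr0.
have -> : (Q%:R : R[i]) = (Q%:R)%:C%C by rewrite rmorph_nat.
rewrite complex_ReM mul0r subr0 complex_Re_sum.
under [in RHS]eq_bigr do rewrite normc_sqr.
by rewrite /=; ring.
Qed.

(** In the Taylor polynomial of [exp (t P)] the powers from [1] to [K - 1] average exactly to zero
    and the constant term gives [1]; only the remainder is left. *)
Lemma avg_exp_trig_poly (A t : R) K Q : (0 < K)%N -> (K * D < Q)%N ->
  (forall x, `|complex.Re (t%:C%C * trig_poly n a x)| <= A /\
             `|complex.Im (t%:C%C * trig_poly n a x)| <= A) ->
  `|(\sum_(l < Q) expR (t * complex.Re (trig_poly n a (node Q l))) *
       cos (t * complex.Im (trig_poly n a (node Q l)))) / Q%:R - 1| <=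
    expR A * ((2 * A) ^+ K / K`!%:R).
Proof.
move=> K0 KQ hA; set C := (X in _ <= X).
have Q0 : (0 < Q)%N by exact: leq_ltn_trans KQ.
have Q0' : 0 < Q%:R :> R by rewrite ltr0n.
pose P l := trig_poly n a (node Q l).
pose T l : R := \sum_(k < K) complex.Re ((t%:C%C * P l) ^+ k) / k`!%:R.
have tay l : `|expR (t * complex.Re (P l)) * cos (t * complex.Im (P l)) - T l| <= C.
  have [h1 h2] := hA (node Q l).
  have [+ _] := @exp_taylor R _ A K 1 h1 h2 (introT andP (conj ler01 (lexx 1))).
  rewrite !mul1r complex_ReM complex_ImM !mul0r subr0 addr0 expr1n mulr1 -/(P l) -/C /T.
  by under eq_bigr do rewrite expr1n mul1r.
have ST : \sum_(l < Q) T l = Q%:R.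
  rewrite /T exchange_big /= (bigD1 (Ordinal K0)) //= [X in _ + X]big1.
    by rewrite addr0 fact0 divr1 /= sumr_const card_ord.
  move=> k k0; rewrite -mulr_suml -complex_Re_sum.
  under eq_bigr do rewrite exprMn.
  rewrite -mulr_sumr sum_trig_poly_expr ?lt0n ?mulr0 ?mul0r //.
  by apply: leq_ltn_trans KQ; rewrite leq_mul2r ltnW ?orbT.
pose E l := expR (t * complex.Re (P l)) * cos (t * complex.Im (P l)).
have -> : (\sum_(l < Q) E l) / Q%:R - 1 = (\sum_(l < Q) (E l - T l)) / Q%:R.
  by rewrite sumrB ST; field; rewrite gt_eqF.
rewrite normrM normfV (gtr0_norm Q0') ler_pdivrMr //.
apply: le_trans (ler_norm_sum _ _ _) _.
apply: (@le_trans _ _ (\sum_(l < Q) C)); first by apply: ler_sum => l _; exact: tay.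
by rewrite sumr_const card_ord mulr_natr.
Qed.

End RootsOfUnity.

(** * Averaging the pointwise inequality over the circle *)

Section MeanInequality.
Context {R : realType} (N : nat) (n : 'I_N -> nat) (a : 'I_N -> R[i]).
Hypotheses (n_pos : forall k, (0 < n k)%N) (n_inj : injective n).
Let D := (\max_(k < N) n k)%N.
Let P x : R[i] := trig_poly n a x.
Let S : R := \sum_(k < N) cabs (a k) ^+ 2.
Variables (M V B : R).
Hypotheses (PM : forall x, - M <= complex.Re (P x))
  (PB : forall x, `|complex.Re (P x)| <= B) (PV : forall x, `|complex.Im (P x)| <= V).

(** The real part has average zero, so it has no positive lower bound. *)
Lemma lower_bound_ge0 : 0 <= M.
Proof.
have DQ : (1 * D < D.+1)%N by rewrite mul1n.
have := congr1 (@complex.Re R) (sum_trig_poly_expr a n_pos (isT : 0 < 1)%N DQ).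
rewrite complex_Re_sum /= => h.
have : \sum_(l < D.+1) - M <= 0 :> R.
  by rewrite -[leRHS]h; apply: ler_sum => l _; exact: PM.
by rewrite sumr_const card_ord mulNrn oppr_le0 pmulrn_lge0.
Qed.

(** The left side is the average of the squared imaginary part. This later shows that the sup norm
    is positive. *)
Lemma sum_cabs_sqr_le : S / 2 <= V ^+ 2.
Proof.
have DQ : (2 * D < (2 * D).+1)%N by [].
have Q0 : 0 < (2 * D).+1%:R :> R by [].
rewrite -(ler_pM2l Q0) -(sum_Im_trig_poly_sqr a n_pos n_inj DQ).
apply: (@le_trans _ _ (\sum_(l < (2 * D).+1) V ^+ 2)); last first.
  by rewrite sumr_const card_ord mulr_natl.
apply: ler_sum => l _; rewrite -(real_normK (num_real _)).
by rewrite lerXn2r ?nnegrE // (le_trans _ (PV 0)).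
Qed.

(** The number of nodes grows with the Taylor order [K.+2], so averaging stays exact; the shift by
    two also ensures [2 * D < Q], as [sum_Im_trig_poly_sqr] requires. *)
Lemma cvg_avg_exp (t : R) :
  ((fun K => let Q := (K.+2 * D).+1 in
    (\sum_(l < Q) expR (t * complex.Re (P (node Q l))) *
       cos (t * complex.Im (P (node Q l)))) / Q%:R) @ \oo --> (1 : R))%classic.
Proof.
set u := fun K => _; pose A := `|t| * (B + V).
have B0 : 0 <= B := le_trans (normr_ge0 _) (PB 0).
have V0 : 0 <= V := le_trans (normr_ge0 _) (PV 0).
have hA x : `|complex.Re (t%:C%C * P x)| <= A /\ `|complex.Im (t%:C%C * P x)| <= A.
  rewrite complex_ReM complex_ImM !mul0r subr0 addr0 !normrM.
  by split; apply: ler_pM => //; [have := PB x|have := PV x]; lra.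
have bd K : `|u K - 1| <= expR A * ((2 * A) ^+ K.+2 / K.+2`!%:R).
  by apply: avg_exp_trig_poly => //.
have e0 : ((fun K => expR A * ((2 * A) ^+ K.+2 / K.+2`!%:R)) @ \oo --> (0 : R))%classic.
  rewrite -[X in (_ --> X)%classic](mulr0 (expR A)); apply: cvgMl_tmp.
  have := @cvg_exp_coeff R (2 * A); rewrite -(cvg_shiftn 2).
  by under eq_fun do rewrite addn2.
apply/cvgrPdist_le => e e_gt0.
move/cvgrPdist_le : e0 => /(_ _ e_gt0); apply: filterS => K.
rewrite sub0r normrN distrC => h; apply: le_trans h.
exact: le_trans (bd K) (ler_norm _).
Qed.

Lemma mean_inequality (c : R) J q : 0 < q < 1 -> 0 < c -> c * V = pi / 2 ->
  alt_cos J 3 (q * expR (- (c * M))) 0 <=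
  (pi / 4 + trunc_err J q) / 2 * (pi ^+ 2 / 4 - c ^+ 2 * S / 2).
Proof.
move=> /andP[q0 q1] c0 cV; set C := (pi / 4 + _) / 2.
pose coef j : R := (-1) ^+ j * ((q * expR (- (c * M))) ^+ j.*2.+1 / oddn j ^+ 3).
pose Q K := (K.+2 * D).+1.
pose avg j K := (\sum_(l < Q K)
  expR (- (oddn j * c) * complex.Re (P (node (Q K) l))) *
  cos (- (oddn j * c) * complex.Im (P (node (Q K) l)))) / (Q K)%:R.
have bd K : \sum_(j < J) coef j * avg j K <= C * (pi ^+ 2 / 4 - c ^+ 2 * S / 2).
  have QK : 0 < (Q K)%:R :> R by [].
  (* This is [alt_cos3_le] at radius [q * expR (- (c * (u + M)))], at most [q] since [u >= - M], and
     angle [c * v], at most [pi / 2] in modulus since [c * V = pi / 2]. *)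
  have pt x : \sum_(j < J) coef j * (expR (- (oddn j * c) * complex.Re (P x)) *
      cos (- (oddn j * c) * complex.Im (P x))) <=
      C * (pi ^+ 2 / 4) - C * c ^+ 2 * complex.Im (P x) ^+ 2.
    set u := complex.Re (P x); set v := complex.Im (P x).
    have qe : 0 <= q * expR (- (c * (u + M))) <= q.
      rewrite mulr_ge0 ?expR_ge0 ?(ltW q0) //= ler_piMr ?(ltW q0) //.
      rewrite -expR0 ler_expR oppr_le0 mulr_ge0 ?(ltW c0) //.
      by have := PM x; rewrite -/u; lra.
    have vc : `|c * v| <= pi / 2.
      by rewrite normrM (gtr0_norm c0) -cV ler_pM2l // PV.
    have := alt_cos3_le J qe q1 vc; rewrite -/C => h.
    have -> : C * (pi ^+ 2 / 4) - C * c ^+ 2 * v ^+ 2 =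
      C * (pi ^+ 2 / 4 - (c * v) ^+ 2) by ring.
    apply: le_trans h; rewrite le_eqVlt; apply/orP; left; apply/eqP.
    apply: eq_bigr => j _; rewrite (mulNr _ v) cosN -(mulrA (oddn j) c v).
    have -> : q * expR (- (c * (u + M))) = q * expR (- (c * M)) * expR (- (c * u)).
      by rewrite -mulrA -expRD; congr (_ * expR _); ring.
    have -> : - (oddn j * c) * u = (j.*2.+1)%:R * - (c * u) by rewrite /oddn; ring.
    by rewrite expRM_natl exprMn /coef; ring.
  have := @ler_sum R _ (index_enum 'I_(Q K)) predT _ _ (fun l _ => pt (node (Q K) l)).
  rewrite exchange_big /= sumrB sumr_const card_ord -mulr_sumr.
  rewrite sum_Im_trig_poly_sqr // -/S; last first.
    by rewrite ltnS leq_mul2r ltnS orbT.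
  rewrite -(ler_pM2r (x := (Q K)%:R^-1)) ?invr_gt0 // => h.
  rewrite [leLHS](_ : _ = (\sum_(j < J) \sum_(l < Q K)
    coef j * (expR (- (oddn j * c) * complex.Re (P (node (Q K) l))) *
      cos (- (oddn j * c) * complex.Im (P (node (Q K) l))))) / (Q K)%:R).
    apply: le_trans h _; rewrite -[C * (pi ^+ 2 / 4) *+ _]mulr_natr.
    by rewrite le_eqVlt; apply/orP; left; apply/eqP; field; rewrite gt_eqF.
  rewrite mulr_suml; apply: eq_bigr => j _.
  by rewrite -mulr_sumr mulrA.
(* Each averaged exponential tends to [1], which leaves the value of the partial sum at [u = 0],
   [v = 0]. *)
have lim : ((fun K => \sum_(j < J) coef j * avg j K) @ \oo -->
    \sum_(j < J) coef j * 1)%classic.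
  apply: cvg_big => [|j _].
    by move=> z; apply: cvgD; [exact: cvg_fst|exact: cvg_snd].
  by apply: cvgMl_tmp; exact: cvg_avg_exp.
have -> : alt_cos J 3 (q * expR (- (c * M))) 0 = \sum_(j < J) coef j * 1.
  by rewrite alt_cos0E; apply: eq_bigr => j _; rewrite mulr1.
rewrite -(cvg_lim _ lim) //; apply: limr_le; first exact: cvgP lim.
by near=> K; exact: bd.
Unshelve. all: by end_near. Qed.

End MeanInequality.

(** * Choice of the scaling and derivation of both estimates *)

Theorem corollary2 (R : realType) (N : nat) (n : 'I_N -> nat)
    (a : 'I_N -> R[i])
    (hN : (1 <= N)%N)
    (n_pos : forall k, (0 < n k)%N)
    (n_incr : forall j k : 'I_N, (j < k)%N -> (n j < n k)%N)
    (a_nz : exists k, a k != 0) :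
  let P := fun x : R => trig_poly n a x in
  let f := fun x : R => complex.Re (P x) in
  let f_tilde := fun x : R => complex.Im (P x) in
  let M := - minT f in
  pi ^+ 2 / (32 * catalan R) *
    ((\sum_(k < N) cabs (a k) ^+ 2) / supnormT f_tilde) <= M
  /\ ((forall k, 1 <= cabs (a k)) ->
      pi ^+ 2 / (32 * catalan R) * (N%:R / supnormT f_tilde) <= M).
Proof.
move=> P f f_tilde M; set V := supnormT _; set S := \sum_(k < N) _.
have n_inj : injective n.
  move=> j k e; apply/val_inj.
  by case: (ltngtP j k) => // /n_incr; rewrite e ltnn.
have fc := @continuous_Re_trig_poly R N n a.
have fp := @periodic_Re_trig_poly R N n a.
(* As [Im z = Re (- i z)], continuity and periodicity of real parts also cover [f_tilde]. *)
pose b k : R[i] := - 'i%C * a k.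
have ftE : f_tilde = fun x => complex.Re (trig_poly n b x).
  apply/funext => x; rewrite /f_tilde /P /trig_poly /b.
  under [in RHS]eq_bigr do rewrite -mulrA.
  by rewrite -mulr_sumr; case: (\sum_(_ < _) _) => u v /=; ring.
have fM x : - M <= f x.
  by rewrite opprK; have [x0 -> hx] := minT_attained fc fp; exact: hx.
have [x1 _ fB] := supnormT_attained fc fp.
have fV x : `|f_tilde x| <= V.
  rewrite /V ftE.
  have [x2 -> hx] := supnormT_attained (@continuous_Re_trig_poly R N n b)
    (@periodic_Re_trig_poly R N n b).
  exact: hx.
have S0 : 0 < S.
  have [k ak] := a_nz; rewrite /S (bigD1 k) //= ltr_pwDl //.
    rewrite exprn_gt0 // lt_def; apply/andP; split.
      by apply: contraNneq ak => /ComplexField.Normc.eq0_normc ->.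
    by case: (a k) => u v; rewrite /cabs /= sqrtr_ge0.
  by apply: sumr_ge0 => j _; rewrite sqr_ge0.
have V0 : 0 < V.
  rewrite lt_def (le_trans _ (fV 0)) // andbT; apply/eqP => V0.
  by have := sum_cabs_sqr_le n_pos n_inj fV; rewrite V0 -/S expr0n /=; lra.
have M0 : 0 <= M by exact: (lower_bound_ge0 n_pos fM).
pose c := pi / (2 * V).
have c0 : 0 < c by rewrite divr_gt0 ?pi_gt0 ?mulr_gt0.
have cV : c * V = pi / 2 by rewrite /c; field; rewrite gt_eqF.
have main : pi / 16 * (c ^+ 2 * S) <= catalan R * (c * M).
  apply: catalan_bound; first by rewrite mulr_ge0 // ltW.
  by move=> J q q01; exact: (mean_inequality n_pos n_inj fM fB fV).
(* Positivity is read off from [main], whose left side is positive. *)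
have G0 : 0 < catalan R.
  rewrite lt_def catalan_ge0 andbT; apply/eqP => G0; move: main.
  have : 0 < pi / 16 * (c ^+ 2 * S) :> R.
    by apply: mulr_gt0; [rewrite divr_gt0 ?pi_gt0|apply: mulr_gt0; rewrite ?exprn_gt0].
  by rewrite G0 mul0r; lra.
(* Multiplied by [catalan R * c], the left side becomes that of [main], since [c = pi / (2 * V)]. *)
have first : pi ^+ 2 / (32 * catalan R) * (S / V) <= M.
  rewrite -(ler_pM2l (mulr_gt0 G0 c0)) -[leRHS]mulrA; apply: le_trans main.
  rewrite le_eqVlt; apply/orP; left; apply/eqP.
  by rewrite /c; field; rewrite !gt_eqF.
split=> // a1; apply: le_trans first.
apply: ler_wpM2l; first by rewrite divr_ge0 ?sqr_ge0 // mulr_ge0 // ltW.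
rewrite ler_pM2r ?invr_gt0 // -[N in N%:R]card_ord -sum1_card natr_sum.
by apply: ler_sum => k _; rewrite expr_ge1 // (le_trans _ (a1 k)).
Qed.
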